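(* Let $F$ be a real-closed field, and let $Q=(-1,-1)_F$ be the quaternion division algebra over $F$. Then $Q^*$ contains no abelian maximal subgroup.
   Context: A field $F$ is real-closed if it is formally real and has no formally real proper algebraic extension; equivalently, $\sqrt{-1}\notin F$ and $F(\sqrt{-1})$ is algebraically closed. The quaternion division algebra over $F$ is $Q=F+Fi+Fj+Fk$ with $i^2=j^2=-1$ and $ij=-ji=k$. $Q^*=Q\setminus\{0\}$ is its multiplicative group. A maximal subgroup of a group $G$ is a proper subgroup not properly contained in any proper subgroup of $G$. *)

(* Defs.v *)
From HB Require Import structures.
From mathcomp Require Import all_boot all_order all_algebra.
From mathcomp Require Import boolp classical_sets.
From mathcomp Require Import ring.

Set Implicit Arguments.
Unset Strict Implicit.
Unset Printing Implicit Defensive.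
Import Order.TTheory GRing.Theory Num.Theory.
Local Open Scope ring_scope.

(* [Quat a b c d] is a + b i + c j + d k in the quaternion algebra (-1,-1)_F. *)
Record quat (F : Type) : Type :=
  Quat { qre : F; qim_i : F; qim_j : F; qim_k : F }.

Section QuatChoice.
Context {F : choiceType}.

Definition quat_tuple (q : quat F) : F * F * F * F :=
  (qre q, qim_i q, qim_j q, qim_k q).

Definition tuple_quat (t : F * F * F * F) : quat F :=
  Quat t.1.1.1 t.1.1.2 t.1.2 t.2.

Lemma quat_tupleK : cancel quat_tuple tuple_quat.
Proof. by case. Qed.

HB.instance Definition _ := Choice.copy (quat F) (can_type quat_tupleK).

End QuatChoice.

Section QuatAlgebra.
Context {F : comNzRingType}.
Implicit Types p q r : quat F.

Definition quat_i : quat F := Quat 0 1 0 0.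
Definition quat_j : quat F := Quat 0 0 1 0.
Definition quat_k : quat F := Quat 0 0 0 1.

Definition addq p q : quat F :=
  Quat (qre p + qre q) (qim_i p + qim_i q)
       (qim_j p + qim_j q) (qim_k p + qim_k q).

Definition oppq p : quat F :=
  Quat (- qre p) (- qim_i p) (- qim_j p) (- qim_k p).

(* The bilinear extension of i^2 = j^2 = -1 and ij = -ji = k. *)
Definition mulq p q : quat F :=
  let: Quat a b c d := p in
  let: Quat a' b' c' d' := q in
  Quat (a * a' - b * b' - c * c' - d * d')
       (a * b' + b * a' + c * d' - d * c')
       (a * c' - b * d' + c * a' + d * b')
       (a * d' + b * c' - c * b' + d * a').

Definition scaleq (x : F) p : quat F :=
  Quat (x * qre p) (x * qim_i p) (x * qim_j p) (x * qim_k p).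

Lemma addqA : associative addq.
Proof. by move=> p q r; rewrite /addq /= !addrA. Qed.

Lemma addqC : commutative addq.
Proof. by move=> p q; congr Quat; rewrite addrC. Qed.

Lemma add0q : left_id (Quat 0 0 0 0) addq.
Proof. by case=> a b c d; rewrite /addq /= !add0r. Qed.

Lemma addNq : left_inverse (Quat 0 0 0 0) oppq addq.
Proof. by case=> a b c d; rewrite /addq /= !addNr. Qed.

Lemma mulqA : associative mulq.
Proof. by case=> ? ? ? ? [? ? ? ?] [? ? ? ?]; congr Quat; ring. Qed.

Lemma mul1q : left_id (Quat 1 0 0 0) mulq.
Proof. by case=> ? ? ? ?; congr Quat; ring. Qed.

Lemma mulq1 : right_id (Quat 1 0 0 0) mulq.
Proof. by case=> ? ? ? ?; congr Quat; ring. Qed.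

Lemma mulqDl : left_distributive mulq addq.
Proof. by case=> ? ? ? ? [? ? ? ?] [? ? ? ?]; congr Quat => /=; ring. Qed.

Lemma mulqDr : right_distributive mulq addq.
Proof. by case=> ? ? ? ? [? ? ? ?] [? ? ? ?]; congr Quat => /=; ring. Qed.

Lemma oneq_neq0 : Quat 1 0 0 0 != Quat 0 0 0 0 :> quat F.
Proof. by apply/eqP => -[] /eqP; rewrite oner_eq0. Qed.

HB.instance Definition _ := GRing.isNzRing.Build (quat F)
  addqA addqC add0q addNq mulqA mul1q mulq1 mulqDl mulqDr oneq_neq0.

Lemma scaleqA (x y : F) p : scaleq x (scaleq y p) = scaleq (x * y) p.
Proof. by rewrite /scaleq /= !mulrA. Qed.

Lemma scale1q : left_id 1 scaleq.
Proof. by case=> ? ? ? ?; rewrite /scaleq /= !mul1r. Qed.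

Lemma scaleqDr : right_distributive scaleq +%R.
Proof. by move=> x p q; congr Quat; rewrite /= mulrDr. Qed.

Lemma scaleqDl p : {morph scaleq^~ p : x y / x + y}.
Proof. by move=> x y; congr Quat; rewrite /= mulrDl. Qed.

HB.instance Definition _ := GRing.Zmodule_isLmodule.Build F (quat F)
  scaleqA scale1q scaleqDr scaleqDl.

Lemma scaleqAl (x : F) p q : x *: (p * q) = (x *: p) * q.
Proof. by case: p q => ? ? ? ? [? ? ? ?]; congr Quat => /=; ring. Qed.

HB.instance Definition _ := GRing.Lmodule_isLalgebra.Build F (quat F) scaleqAl.

Lemma scaleqAr (x : F) p q : x *: (p * q) = p * (x *: q).
Proof. by case: p q => ? ? ? ? [? ? ? ?]; congr Quat => /=; ring. Qed.

HB.instance Definition _ := GRing.Lalgebra_isAlgebra.Build F (quat F) scaleqAr.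

Lemma quatE (a b c d : F) :
  Quat a b c d = a%:A + b *: quat_i + c *: quat_j + d *: quat_k.
Proof. by congr Quat => /=; ring. Qed.

Lemma quat_ii : quat_i * quat_i = -1.
Proof. by congr Quat => /=; ring. Qed.

Lemma quat_jj : quat_j * quat_j = -1.
Proof. by congr Quat => /=; ring. Qed.

Lemma quat_ij : quat_i * quat_j = quat_k.
Proof. by congr Quat => /=; ring. Qed.

Lemma quat_ji : quat_j * quat_i = - quat_k.
Proof. by congr Quat => /=; ring. Qed.

Definition conjq p : quat F :=
  Quat (qre p) (- qim_i p) (- qim_j p) (- qim_k p).

Definition normq p : F :=
  qre p ^+ 2 + qim_i p ^+ 2 + qim_j p ^+ 2 + qim_k p ^+ 2.

Lemma mulq_conj p : p * conjq p = (normq p)%:A.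
Proof. by case: p => ? ? ? ?; congr Quat; rewrite /normq /=; ring. Qed.

Lemma mulconj_q p : conjq p * p = (normq p)%:A.
Proof. by case: p => ? ? ? ?; congr Quat; rewrite /normq /=; ring. Qed.

End QuatAlgebra.

Section QuatDivision.
Context {F : realFieldType}.
Implicit Types p q : quat F.

Lemma normq_eq0 p : (normq p == 0) = (p == 0).
Proof.
apply/eqP/eqP => [|->]; last by rewrite /normq /= expr0n /= !addr0.
case: p => a b c d; rewrite /normq /= => /eqP.
rewrite !paddr_eq0 ?addr_ge0 ?sqr_ge0 // !sqrf_eq0.
by move=> /andP[/andP[/andP[/eqP-> /eqP->] /eqP->] /eqP->].
Qed.

Definition invq p : quat F := (normq p)^-1 *: conjq p.

Lemma mulVq : {in [pred p | p != 0], left_inverse 1 invq *%R}.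
Proof.
move=> p; rewrite inE -normq_eq0 => p0.
by rewrite -scalerAl mulconj_q scalerA mulVf // scale1r.
Qed.

Lemma mulqV : {in [pred p | p != 0], right_inverse 1 invq *%R}.
Proof.
move=> p; rewrite inE -normq_eq0 => p0.
by rewrite -scalerAr mulq_conj scalerA mulVf // scale1r.
Qed.

Lemma quat_unitP p q : q * p = 1 /\ p * q = 1 -> p != 0.
Proof.
by case=> qp _; apply: contra_eq_neq qp => ->; rewrite mulr0 eq_sym oner_neq0.
Qed.

Lemma invq_out : {in [predC [pred p | p != 0]], invq =1 id}.
Proof.
move=> p; rewrite !inE negbK => /eqP->.
by rewrite /invq (eqP (_ : normq 0 == 0)) ?normq_eq0 // invr0 scale0r.
Qed.

HB.instance Definition _ := GRing.NzRing_hasMulInverse.Build (quat F)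
  mulVq mulqV quat_unitP invq_out.

Lemma quat_unitE p : (p \is a GRing.unit) = (p != 0).
Proof. by []. Qed.

End QuatDivision.

(* By [quat_unitE], [units (quat F)] is the set of nonzero quaternions. *)
Definition units (R : unitRingType) : Type := {x : R | x \is a GRing.unit}.

Section Units.
Context {R : unitRingType}.

HB.instance Definition _ := SubChoice.on (units R).

Definition oneu : units R := Sub 1 (unitr1 R).

Lemma mulu_subproof (u v : units R) : val u * val v \is a GRing.unit.
Proof. by rewrite unitrMl (valP u, valP v). Qed.

Definition mulu (u v : units R) : units R :=
  Sub (val u * val v) (mulu_subproof u v).

Lemma invu_subproof (u : units R) : (val u)^-1 \is a GRing.unit.
Proof. by rewrite unitrV (valP u). Qed.

Definition invu (u : units R) : units R :=
  Sub (val u)^-1 (invu_subproof u).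

Lemma muluA : associative mulu.
Proof. by move=> u v w; apply: val_inj; rewrite /= mulrA. Qed.

Lemma mul1u : left_id oneu mulu.
Proof. by move=> u; apply: val_inj; rewrite /= mul1r. Qed.

Lemma mulu1 : right_id oneu mulu.
Proof. by move=> u; apply: val_inj; rewrite /= mulr1. Qed.

Lemma mulVu : left_inverse oneu invu mulu.
Proof. by move=> u; apply: val_inj; rewrite /= mulVr ?(valP u). Qed.

Lemma muluV : right_inverse oneu invu mulu.
Proof. by move=> u; apply: val_inj; rewrite /= divrr ?(valP u). Qed.

HB.instance Definition _ :=
  isGroup.Build (units R) muluA mul1u mulu1 mulVu muluV.

End Units.

(* Subgroups of a possibly infinite group, as arbitrary (not necessarily
   decidable) subsets. *)
Section Subgroups.
Context {G : groupType}.
Implicit Types H M : set G.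
Local Open Scope classical_set_scope.

Definition subgroup H : Prop := group_closed (mem H).

Definition proper_subgroup H : Prop := subgroup H /\ H `<` [set: G].

Definition maximal_subgroup M : Prop :=
  proper_subgroup M /\ forall H, proper_subgroup H -> ~ M `<` H.

Definition abelian_set H : Prop := {in H &, forall x y, commute x y}.

End Subgroups.

(* Main.v *)
Require Import Defs.
From mathcomp Require Import all_boot all_order all_algebra.
From mathcomp Require Import boolp classical_sets.
From mathcomp Require Import ring lra.

(** If [M] is abelian, then some quaternion [x] with [conjq x <> x] commutes with
    [M]: an element of [M], or [i] when [M] is central. The nonzero [q] with
    [q x = x q] or [q x = conjq x q] form the normalizer of the multiplicative
    group of [F(x)]. It contains [M]; it also contains a [v] orthogonal to [1]
    and [x], which does not commute with [x], hence is not in [M]; and it does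
    not contain [1 + v]. So [M] is not maximal. *)

Set Implicit Arguments.
Unset Strict Implicit.
Unset Printing Implicit Defensive.
Import Order.TTheory GRing.Theory Num.Theory.
Local Open Scope ring_scope.

Section TwistNormalizer.
Context {F : realFieldType}.
Implicit Types (q x y v : quat F).

Lemma add_conjq x : x + conjq x = (qre x *+ 2)%:A.
Proof. by case: x => a b c d; congr Quat => /=; ring. Qed.

Lemma conjq_fixed x : conjq x = x -> x = (qre x)%:A.
Proof. by case: x => a b c d [? ? ?]; congr Quat => /=; lra. Qed.

Lemma conjqK : involutive (@conjq F).
Proof. by case=> a b c d; rewrite /conjq /= !opprK. Qed.

(** Equal real parts make [x + conjq x] and [y + conjq y] the same scalar, which commutes with [q];
    subtracting [q * x = y * q] leaves the claim. *)
Lemma intertwine_conjq q x y :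
  qre x = qre y -> q * x = y * q -> q * conjq x = conjq y * q.
Proof.
move=> xy qx; apply: (addrI (q * x)).
rewrite {2}qx -mulrDr -mulrDl !add_conjq xy.
by rewrite -scalerAr -scalerAl mulr1 mul1r.
Qed.

(** A pure quaternion orthogonal to the imaginary part of [x] anticommutes with it. *)
Lemma twist_neq0 x : exists2 v, v != 0 & v * x = conjq x * v.
Proof.
case: x => a b c d; have [/eqP|bc] := eqVneq (b ^+ 2 + c ^+ 2) 0.
  rewrite paddr_eq0 ?sqr_ge0 // !sqrf_eq0 => /andP[/eqP-> /eqP->].
  exists quat_i; last by congr Quat => /=; ring.
  by apply/eqP => -[] /eqP; rewrite oner_eq0.
(* The vector [(-c, b, 0)] is orthogonal to [(b, c, d)]; it vanishes only in the case [b = c = 0]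
   settled above with [i]. *)
exists (Quat 0 (- c) b 0); last by congr Quat => /=; ring.
by apply: contraNneq bc => -[/eqP]; rewrite oppr_eq0 => /eqP-> ->;
  rewrite expr0n addr0.
Qed.

Definition twist_normalizer x : set (units (quat F)) :=
  fun u => val u * x = x * val u \/ val u * x = conjq x * val u.

Lemma subgroup_twist_normalizer x : subgroup (twist_normalizer x).
Proof.
split=> [|u v]; first by apply/mem_set; left; rewrite mul1r mulr1.
move=> /set_mem Hu /set_mem Hv; apply/mem_set.
have vU := valP v.
have divE y z : val v * y = z * val v ->
    val (u * v^-1)%g * z = val u * y * (val v)^-1.
  move=> vy; change (val (u * v^-1)%g) with (val u / val v).
  by rewrite -!mulrA -[z](mulrK vU) -vy !mulrA mulrVK.
case: Hv => Hv.
  by case: Hu => Hu; [left|right]; rewrite (divE _ _ Hv) Hu -!mulrA.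
(* To move [v^-1] past [x], [divE] needs a relation with right side [x * val v]: conjugating the
   twist by [v] gives it. *)
have {}Hv : val v * conjq x = x * val v.
  by rewrite (intertwine_conjq _ Hv) ?conjqK.
case: Hu => Hu; [right|left]; rewrite (divE _ _ Hv).
  by rewrite (intertwine_conjq _ Hu) // -!mulrA.
by rewrite (intertwine_conjq _ Hu) ?conjqK // -!mulrA.
Qed.

Lemma twist_normalizer_nontrivial x : conjq x != x ->
  exists2 v : units (quat F), twist_normalizer x v /\ val v * x != x * val v
    & exists w, ~ twist_normalizer x w.
Proof.
move=> xN; have [v v0 vx] := twist_neq0 x.
have vU : v \is a GRing.unit by rewrite quat_unitE.
have vNx : v * x != x * v.
  by rewrite vx; apply: contra_neq xN; apply: (mulIr vU).
exists (Sub v vU) => /=; first by split; [right|].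
(* Since [v] twists [x], if [1 + v] commuted with [x], so would [v]; if it twisted [x], then
   [x = conjq x]. *)
have wU : 1 + v \is a GRing.unit.
  rewrite quat_unitE; apply: contra_neq vNx => /eqP.
  by rewrite addrC addr_eq0 => /eqP->; rewrite mulN1r mulrN1.
exists (Sub (1 + v) wU) => -[] /=; rewrite mulrDl mulrDr mul1r mulr1.
  by move/addrI; apply/eqP.
by rewrite vx => /addIr/esym; apply/eqP.
Qed.

Lemma abelian_centralizer_noncentral (M : set (units (quat F))) :
  abelian_set M ->
  exists2 x, conjq x != x & forall u, M u -> val u * x = x * val u.
Proof.
move=> Mab; have [[m Mm mN]|Mcentral] :=
  pselect (exists2 m, M m & conjq (val m) != val m).
  exists (val m) => // u Mu.
  by have /(congr1 val) := Mab u m (mem_set Mu) (mem_set Mm).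
exists quat_i => [|u Mu].
  by apply/eqP; case=> *; lra.
(* Here conjugation fixes all of [M], so its elements are scalars. *)
have /conjq_fixed -> : conjq (val u) = val u.
  by apply: contrapT => /eqP uN; apply: Mcentral; exists u.
by rewrite -scalerAl -scalerAr mul1r mulr1.
Qed.

Lemma abelian_not_maximal (M : set (units (quat F))) :
  abelian_set M -> ~ maximal_subgroup M.
Proof.
move=> /abelian_centralizer_noncentral[x xN Mx] [_ Mmax].
have [v [Nv vN] [w wN]] := twist_normalizer_nontrivial xN.
apply: (Mmax (twist_normalizer x)); split.
- exact: subgroup_twist_normalizer.
- by split=> // NT; apply/wN/NT.
- by move=> u /Mx; left.
- by move=> NM; move/eqP: vN; apply; apply/Mx/NM.
Qed.

End TwistNormalizer.

Theorem proposition5p3 (F : rcfType) :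
  ~ exists M : set (units (quat F)), maximal_subgroup M /\ abelian_set M.
Proof. by move=> [M [Mmax Mab]]; apply: abelian_not_maximal Mab Mmax. Qed.
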